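(* Fix $n\ge 1$ and a conservative pseudo-adder on $n$-bit inputs satisfying the standing assumption. Let $\mathrm{Er}(a,b)=|s(a,b)-s'(a,b)|$. The mean squared error, i.e. the expectation of $(\mathrm{Er}(a,b))^2$ for $(a,b)$ uniformly distributed on $\{0,\dots,2^n-1\}^2$, equals $$\frac{1}{2^{2n}}\Biggl(\sum_{C}\nu(C)\cdot(\mathrm{EC}(C))^2+\sum_{C_1\ne C_2}\nu(C_1,C_2)\cdot\mathrm{EC}(C_1)\cdot\mathrm{EC}(C_2)\Biggr),$$ where $C$ ranges over all carry chains ($i$-$j$ carry chains with $1\le i\le j\le n$) and $(C_1,C_2)$ ranges over all ordered pairs of distinct carry chains.
   Context: Inputs: integers $a,b\in\{0,\dots,2^n-1\}$ with binary digits $a_k,b_k$ for $0\le k\le n$, so $a_n=b_n=0$. True carries and sum bits: $c_0=0$, $c_k=a_{k-1}b_{k-1}\lor a_{k-1}c_{k-1}\lor b_{k-1}c_{k-1}$ for $1\le k\le n$, and $s_k=a_k\oplus b_k\oplus c_k$ for $0\le k\le n$; so $s(a,b)=\sum_{k=0}^n s_k2^k=a+b$. Carry chains: for $1\le i\le j\le n$, the pair $(a,b)$ generates the $i$-$j$ carry chain if $a_{i-1}=b_{i-1}=1$, $a_k\ne b_k$ for $i\le k\le j-1$, and $a_j=b_j$. A carry chain is identified with the pair $(i,j)$. Pseudo-adder: functions $c'_k=c'_k(a,b)\in\{0,1\}$ for $0\le k\le n$, where $c'_0=0$ and, for $k\ge1$, $c'_k$ depends only on $a_{k-1},\dots,a_0$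 and $b_{k-1},\dots,b_0$. Its computed sum is $s'(a,b)=\sum_{k=0}^n s'_k2^k$ with $s'_k=a_k\oplus b_k\oplus c'_k$. It is conservative if $c'_k(a,b)\le c_k(a,b)$ for all $k$ and all $(a,b)$. Standing assumption: whenever $(a,b)$ generates the $i$-$j$ carry chain and $i\le k\le j$, the value $c'_k(a,b)$ does not depend on the bits of $a,b$ in positions lower than $i-1$, nor on which pair $(a,b)$ generating the chain is considered. Error of a chain: for an $i$-$j$ carry chain $C$ and any $(a,b)$ generating it, let $(a^C,b^C)$ agree with $(a,b)$ in positions $i-1,\dots,j-1$ and have all other bits $0$. Then $\mathrm{EC}(C)=s(a^C,b^C)-s'(a^C,b^C)$, which by the standing assumption is independent of the choice of $(a,b)$. $\nu(C)$ is the number of input pairs $(a,b)$ generating $C$; for $C_1\ne C_2$, $\nu(C_1,C_2)$ is the number of input pairs $(a,b)$ generating both $C_1$ and $C_2$. *)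

(* Defs.v *)
From mathcomp Require Import all_boot all_order all_algebra.

Set Implicit Arguments.
Unset Strict Implicit.
Unset Printing Implicit Defensive.

Import Order.TTheory GRing.Theory Num.Theory.

Notation input n := 'I_(2 ^ n).

Definition bit (a k : nat) : bool := odd (a %/ 2 ^ k).

Fixpoint carry (a b k : nat) : bool :=
  if k is k'.+1 then
    [|| bit a k' && bit b k',
        bit a k' && carry a b k' |
        bit b k' && carry a b k']
  else false.

Definition sum_bit (a b k : nat) : bool :=
  bit a k (+) bit b k (+) carry a b k.

Definition exact_sum n (a b : input n) : nat :=
  \sum_(k < n.+1) sum_bit a b k * 2 ^ k.

Record pseudo_adder n := PseudoAdder {
  pcarry :> 'I_n.+1 -> input n -> input n -> bool;
  pcarry0 : forall a b, pcarry ord0 a b = false;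
  pcarry_local : forall (k : 'I_n.+1) (a b x y : input n), 1 <= k ->
    (forall m, m < k -> bit a m = bit x m /\ bit b m = bit y m) ->
    pcarry k a b = pcarry k x y }.

Definition pseudo_sum_bit n (c' : pseudo_adder n) (a b : input n)
    (k : 'I_n.+1) : bool :=
  bit a k (+) bit b k (+) c' k a b.

Definition pseudo_sum n (c' : pseudo_adder n) (a b : input n) : nat :=
  \sum_(k < n.+1) pseudo_sum_bit c' a b k * 2 ^ k.

(* The order on {0,1} is that of nat, through the coercion bool >-> nat. *)
Definition conservative n (c' : pseudo_adder n) : Prop :=
  forall (k : 'I_n.+1) (a b : input n), c' k a b <= carry a b k.

Notation carry_chain n := {C : 'I_n.+1 * 'I_n.+1 | 1 <= C.1 <= C.2}.

Definition chain_start n (C : carry_chain n) : 'I_n.+1 := (val C).1.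
Definition chain_end n (C : carry_chain n) : 'I_n.+1 := (val C).2.

Definition generates n (C : carry_chain n) (a b : input n) : bool :=
  let i := chain_start C in let j := chain_end C in
  [&& bit a i.-1, bit b i.-1,
      [forall k : 'I_n.+1, (i <= k < j) ==> (bit a k != bit b k)] &
      bit a j == bit b j].

(* Generation of C only involves positions >= chain_start C - 1, so altering
   the bits of a generating pair below that position yields another generating
   pair: independence of the generating pair includes independence of the low
   bits. *)
Definition chain_determined n (c' : pseudo_adder n) : Prop :=
  forall (C : carry_chain n) (a b x y : input n),
    generates C a b -> generates C x y ->
    forall k : 'I_n.+1, chain_start C <= k <= chain_end C ->
    c' k a b = c' k x y.

Lemma restrict_subproof n (C : carry_chain n) (a : input n) :
  \sum_(k < n | (chain_start C).-1 <= k < chain_end C) bit a k * 2 ^ k < 2 ^ n.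
Proof.
apply: (@leq_ltn_trans (\sum_(k < n) 2 ^ k)).
  rewrite big_mkcond /=; apply: leq_sum => k _.
  by case: ifP => // _; case: (bit a k); rewrite ?mul1n.
elim: n {C a} => [|n IHn]; first by rewrite big_ord0.
by rewrite big_ord_recr /= expnS mul2n -addnn ltn_add2r.
Qed.

Definition restrict n (C : carry_chain n) (a : input n) : input n :=
  Ordinal (restrict_subproof C a).

(* Computed on an arbitrarily chosen pair generating C. The default value is
   never used, since every chain is generated by some pair, and the value does
   not depend on the choice when c' is conservative and chain_determined. *)
Definition EC n (c' : pseudo_adder n) (C : carry_chain n) : int :=
  if [pick ab : input n * input n | generates C ab.1 ab.2] is Some ab then
    (Posz (exact_sum (restrict C ab.1) (restrict C ab.2))
     - Posz (pseudo_sum c' (restrict C ab.1) (restrict C ab.2)))%R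
  else 0%R.

Definition nu n (C : carry_chain n) : nat :=
  #|[set ab : input n * input n | generates C ab.1 ab.2]|.

Definition nu2 n (C1 C2 : carry_chain n) : nat :=
  #|[set ab : input n * input n |
      generates C1 ab.1 ab.2 && generates C2 ab.1 ab.2]|.

Definition Er n (c' : pseudo_adder n) (a b : input n) : int :=
  (`|Posz (exact_sum a b) - Posz (pseudo_sum c' a b)|)%R.

Definition uniform_expectation (T : finType) (X : T -> rat) : rat :=
  (\sum_(t : T) #|T|%:R^-1 * X t)%R.

Definition mean_squared_error n (c' : pseudo_adder n) : rat :=
  uniform_expectation
    (fun ab : input n * input n => ((Er c' ab.1 ab.2)%:~R ^+ 2)%R).

(* Main.v *)
Require Import Defs.
From mathcomp Require Import all_boot all_order all_algebra.
From mathcomp Require Import zify.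

(** The error of the pseudo-adder is [\sum_k d_k 2^k] with [d_k = s_k - s'_k].
    Conservativity gives [d_k = 0] when [c_k = 0], and each position with
    [c_k = 1] lies in exactly one carry chain generated by the inputs, so the
    error splits over the generated chains. By the standing assumption the part
    carried by a chain [C] is [EC C]: restricting the inputs to [C] changes no
    [d_k] inside [C] and clears all carries outside. The theorem follows by
    squaring the resulting identity and exchanging the sums. *)

Set Implicit Arguments.
Unset Strict Implicit.
Unset Printing Implicit Defensive.

Import Order.TTheory GRing.Theory Num.Theory.
Local Open Scope ring_scope.

(** * Binary digits and carries *)

Lemma bit_sum (n m : nat) (f : nat -> bool) :
  bit (\sum_(k < n) f k * 2 ^ k)%N m = (m < n)%N && f m.
Proof.
elim: n m f => [|n IHn] m f; first by rewrite big_ord0 /bit div0n.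
(* Splitting off the lowest digit leaves an even remainder, whose half is the shorter sum for the
   shifted digits [f \o S]. *)
rewrite big_ord_recl /= expn0 muln1.
under eq_bigr => k _ do rewrite /bump /= add1n expnS mulnCA.
rewrite -big_distrr /= mul2n /bit; case: m => [|m].
  by rewrite expn0 divn1 oddD odd_double addbF oddb.
by rewrite expnS divnMA divn2 half_bit_double -/(bit _ m) (IHn m (f \o S)).
Qed.

Lemma bit_restrict n (C : carry_chain n) (a : input n) m :
  bit (restrict C a) m =
  [&& (m < n)%N, ((chain_start C).-1 <= m < chain_end C)%N & bit a m].
Proof.
have <- := bit_sum n m
  (fun k => ((chain_start C).-1 <= k < chain_end C)%N && bit a k).
by congr bit; rewrite /= big_mkcond; apply: eq_bigr => k _; case: ifP.
Qed.

Lemma bit_overflow n (a : input n) m : (n <= m)%N -> bit a m = false.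
Proof.
by move=> nm; rewrite /bit divn_small // (leq_trans (ltn_ord a)) // leq_exp2l.
Qed.

Lemma carry_kill (a b k : nat) :
  bit a k = false -> bit b k = false -> carry a b k.+1 = false.
Proof. by move=> /= -> ->. Qed.

(** Trace the carry downwards: position [k-1] either creates it or passes on a carry from below. *)
Lemma carry_start (a b k : nat) : carry a b k ->
  exists2 i, (1 <= i <= k)%N & [/\ bit a i.-1, bit b i.-1 &
    forall m, (i <= m < k)%N -> bit a m != bit b m].
Proof.
elim: k => // k IHk /=.
have [/andP[ak bk] _|nab /= ck] := boolP (bit a k && bit b k).
  by exists k.+1; [lia | split=> // m; lia].
have [neq /IHk[i ik [ai bi prop]]] : bit a k != bit b k /\ carry a b k.
  by move: nab ck; case: (bit a k); case: (bit b k); case: (carry a b k).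
exists i; first lia; split=> // m im.
have [->//|mk] := eqVneq m k; apply: prop; lia.
Qed.

Lemma propagates_carry (a b i k : nat) : (1 <= i <= k)%N ->
  bit a i.-1 -> bit b i.-1 ->
  (forall m, (i <= m < k)%N -> bit a m != bit b m) -> carry a b k.
Proof.
elim: k => [|k IHk] ik ai bi prop; first lia.
have [ik1|ik1] := eqVneq i k.+1; first by move: ai bi; rewrite ik1 /= => -> ->.
have ck : carry a b k by apply: IHk => // [|m mk]; [lia | apply: prop; lia].
have /prop : (i <= k < k.+1)%N by lia.
by rewrite /= ck; case: (bit a k); case: (bit b k).
Qed.

(** * Generated chains and carry positions *)

Definition in_chain n (C : carry_chain n) (k : 'I_n.+1) : bool :=
  (chain_start C <= k <= chain_end C)%N.

Lemma chain_bounds n (C : carry_chain n) :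
  (1 <= chain_start C <= chain_end C)%N.
Proof. exact: valP C. Qed.

Lemma generatesP n (C : carry_chain n) (a b : input n) :
  reflect [/\ bit a (chain_start C).-1, bit b (chain_start C).-1,
    forall m, (chain_start C <= m < chain_end C)%N -> bit a m != bit b m &
    bit a (chain_end C) = bit b (chain_end C)] (generates C a b).
Proof.
apply: (iffP and4P) => [[ai bi /forallP prop /eqP aj]|[ai bi prop aj]].
  split=> // m im.
  have mn : (m < n.+1)%N by have := ltn_ord (chain_end C); lia.
  by have /implyP := prop (Ordinal mn); apply.
by split=> //; [apply/forallP=> k; apply/implyP/prop | apply/eqP].
Qed.

Lemma generates_carry n (C : carry_chain n) (a b : input n) k :
  generates C a b -> in_chain C k -> carry a b k.
Proof.
move=> /generatesP[ai bi prop _] /andP[ik kj]; have := chain_bounds C => ij.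
by apply: (propagates_carry _ ai bi) => [|m mk]; [lia | apply: prop; lia].
Qed.

Lemma carry_generates n (a b : input n) (k : 'I_n.+1) : carry a b k ->
  exists2 C : carry_chain n, generates C a b & in_chain C k.
Proof.
move=> /carry_start[i ik [ai bi prop]].
have kn := ltn_ord k.
(* The chain ends at the first position from [k] on where the bits agree. Position [n] qualifies,
   both bits being 0 there, so the end is at most [n]. *)
have exj : exists j, (k <= j)%N && (bit a j == bit b j).
  by exists n; rewrite !bit_overflow // eqxx andbT.
case: (ex_minnP exj) => j /andP[kj /eqP aj] jmin.
have jn : (j < n.+1)%N.
  by rewrite ltnS; apply: jmin; rewrite !bit_overflow // eqxx andbT.
have i_n : (i < n.+1)%N by lia.
have ij : (1 <= (Ordinal i_n, Ordinal jn).1 <= (Ordinal i_n, Ordinal jn).2)%N.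
  by rewrite /=; lia.
exists (exist _ (Ordinal i_n, Ordinal jn) ij); last by rewrite /in_chain /=; lia.
apply/generatesP; split=> //= m /andP[im mj].
have [mk|km] := ltnP m k; first by apply: prop; lia.
by apply/negP=> eqm; have := jmin m; rewrite km eqm => /(_ isT); lia.
Qed.

(** If two overlapping chains differed, the generating position or the end of one would lie where
    the other propagates; but the bits agree at the former and differ at the latter. *)
Lemma generates_inj n (C1 C2 : carry_chain n) (a b : input n) k :
  generates C1 a b -> generates C2 a b -> in_chain C1 k -> in_chain C2 k ->
  C1 = C2.
Proof.
wlog suff le12 : C1 C2 / generates C1 a b -> generates C2 a b ->
    in_chain C1 k -> in_chain C2 k ->
    (chain_start C2 <= chain_start C1)%N && (chain_end C2 <= chain_end C1)%N.
  move=> g1 g2 k1 k2.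
  have /andP[s1 e1] := le12 _ _ g1 g2 k1 k2.
  have /andP[s2 e2] := le12 _ _ g2 g1 k2 k1.
  apply: val_inj; rewrite [LHS]surjective_pairing [RHS]surjective_pairing.
  by congr pair; apply/val_inj/eqP; rewrite /= eqn_leq; apply/andP.
move=> /generatesP[_ _ prop1 eq1] /generatesP[ai2 bi2 prop2 _].
rewrite /in_chain => k1 k2; have b1 := chain_bounds C1; have b2 := chain_bounds C2.
apply/andP; split; rewrite leqNgt; apply/negP => lt.
  have /prop1 : (chain_start C1 <= (chain_start C2).-1 < chain_end C1)%N by lia.
  by rewrite ai2 bi2.
have /prop2 : (chain_start C2 <= chain_end C1 < chain_end C2)%N by lia.
by rewrite eq1 eqxx.
Qed.

Lemma sum_generated_chain n (a b : input n) (k : 'I_n.+1) (x : int) :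
  \sum_(C : carry_chain n | generates C a b && in_chain C k) x =
  if carry a b k then x else 0.
Proof.
case: ifP => [/carry_generates[C gC kC]|nck]; last first.
  by rewrite big_pred0 // => C; apply/andP=> -[gC /(generates_carry gC)]; rewrite nck.
rewrite (big_pred1 C) // => C' /=; apply/andP/eqP => [[gC' kC']|->//].
exact: (generates_inj gC' gC kC' kC).
Qed.

Lemma restrict_generates n (C : carry_chain n) (a b : input n) :
  generates C a b -> generates C (restrict C a) (restrict C b).
Proof.
move=> /generatesP[ai bi prop aj]; have := chain_bounds C => ij.
have := ltn_ord (chain_end C) => jn.
apply/generatesP; rewrite !bit_restrict ai bi; split; try lia.
move=> m im; rewrite !bit_restrict.
have -> : (m < n)%N by lia.
have -> : ((chain_start C).-1 <= m < chain_end C)%N by lia.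
exact: prop.
Qed.

(** For [k] at least 1 outside the chain, [k-1] lies outside the retained window, so both bits there
    are 0 and no carry enters [k]. *)
Lemma carry_restrict n (C : carry_chain n) (a b : input n) (k : 'I_n.+1) :
  ~~ in_chain C k -> carry (restrict C a) (restrict C b) k = false.
Proof.
rewrite /in_chain => nk; have ij := chain_bounds C.
case: (nat_of_ord k) nk => [//|m] nk.
by apply: carry_kill; rewrite bit_restrict; apply/negP=> /and3P[]; lia.
Qed.

(** * Splitting the signed error over chains *)

Section PseudoAdder.

Variables (n : nat) (c' : pseudo_adder n).

(** Signed, since a missed carry can flip the sum bit in either direction. *)
Definition bit_error (a b : input n) (k : 'I_n.+1) : int :=
  Posz (sum_bit a b k) - Posz (pseudo_sum_bit c' a b k).

Lemma sum_error (a b : input n) :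
  Posz (exact_sum a b) - Posz (pseudo_sum c' a b) =
  \sum_(k < n.+1) bit_error a b k * 2 ^+ k.
Proof.
rewrite /exact_sum /pseudo_sum !(big_morph Posz PoszD (erefl (Posz 0))).
rewrite -sumrB; apply: eq_bigr => k _.
by rewrite !PoszM -mulrBl -natrX natz.
Qed.

Hypothesis hcons : conservative c'.

Lemma bit_error0 (a b : input n) (k : 'I_n.+1) :
  carry a b k = false -> bit_error a b k = 0.
Proof.
move=> ck; have := hcons k a b; rewrite ck leqn0 eqb0 => /negbTE c'k.
by rewrite /bit_error /sum_bit /pseudo_sum_bit ck c'k subrr.
Qed.

Lemma sum_error_chains (a b : input n) :
  Posz (exact_sum a b) - Posz (pseudo_sum c' a b) =
  \sum_(C : carry_chain n | generates C a b)
    \sum_(k < n.+1 | in_chain C k) bit_error a b k * 2 ^+ k.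
Proof.
rewrite sum_error (exchange_big_dep xpredT) //=; apply: eq_bigr => k _.
rewrite sum_generated_chain; case: ifP => // ck.
by rewrite bit_error0 ?mul0r.
Qed.

Hypothesis hdet : chain_determined c'.

(** The inputs enter only through the xor of their bits and the two carries. On a chain the xor is 1
    before the end and 0 at it, the true carry is 1, and [hdet] fixes the computed one. *)
Lemma bit_error_chain (C : carry_chain n) (a b x y : input n) (k : 'I_n.+1) :
  generates C a b -> generates C x y -> in_chain C k ->
  bit_error a b k = bit_error x y k.
Proof.
move=> gab gxy kC; rewrite /bit_error /sum_bit /pseudo_sum_bit.
rewrite (generates_carry gab kC) (generates_carry gxy kC) (hdet gab gxy kC).
suff -> : bit a k (+) bit b k = bit x k (+) bit y k by [].
move: gab gxy => /generatesP[_ _ pab eab] /generatesP[_ _ pxy exy].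
move/andP: kC => [ik]; rewrite leq_eqVlt => /orP[/eqP ->|kj].
  by rewrite eab exy !addbb.
have ikj : (chain_start C <= k < chain_end C)%N by rewrite ik.
by move: (pab _ ikj) (pxy _ ikj); do 4!case: (bit _ _).
Qed.

Lemma EC_generates (C : carry_chain n) (a b : input n) : generates C a b ->
  EC c' C = \sum_(k < n.+1 | in_chain C k) bit_error a b k * 2 ^+ k.
Proof.
move=> gab; rewrite /EC; case: pickP => [[x y] /= gxy|/(_ (a, b))]; last first.
  by rewrite /= gab.
(* Inside the chain, the restricted picked pair still generates [C], so its bit errors match those
   of [(a, b)]; outside, its carries vanish. *)
rewrite sum_error [RHS]big_mkcond; apply: eq_bigr => k _.
case: ifPn => [kC|nkC].
  by rewrite (bit_error_chain (restrict_generates gxy) gab kC).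
by rewrite bit_error0 ?mul0r ?carry_restrict.
Qed.

Lemma sum_error_EC (a b : input n) :
  Posz (exact_sum a b) - Posz (pseudo_sum c' a b) =
  \sum_(C : carry_chain n) (generates C a b)%:R * EC c' C.
Proof.
rewrite sum_error_chains big_mkcond; apply: eq_bigr => C _.
by case: ifP => [gC|_]; rewrite ?mul0r // mul1r (EC_generates gC).
Qed.

End PseudoAdder.

(** * Second moment of a weighted sum of indicators *)

Lemma sum_sqr_pairs (I : finType) (R : comPzRingType) (x : I -> R) :
  (\sum_i x i) ^+ 2 =
  \sum_i x i ^+ 2 + \sum_(p : I * I | p.1 != p.2) x p.1 * x p.2.
Proof.
rewrite expr2 big_distrlr /=.
rewrite -(pair_big_dep xpredT (fun i j => i != j) (fun i j => x i * x j)) /=.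
rewrite -big_split /=; apply: eq_bigr => i _.
by rewrite (bigD1 i) //= expr2; congr (_ + _); apply: eq_bigl => j; rewrite eq_sym.
Qed.

Lemma sum_bool_card (T : finType) (R : pzSemiRingType) (P : pred T) :
  \sum_t (P t)%:R = #|[set t | P t]|%:R :> R.
Proof. by rewrite -natr_sum -sum1dep_card [in RHS]big_mkcond. Qed.

(** Indicators are idempotent and their products indicate conjunctions, so summing over [t] first
    turns them into cardinalities. *)
Lemma sum_sqr_indicators (T I : finType) (R : comPzRingType)
    (P : I -> pred T) (x : I -> R) :
  \sum_t (\sum_i (P i t)%:R * x i) ^+ 2 =
  \sum_i #|[set t | P i t]|%:R * x i ^+ 2 +
  \sum_(p : I * I | p.1 != p.2)
    #|[set t | P p.1 t && P p.2 t]|%:R * x p.1 * x p.2.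
Proof.
under eq_bigr => t _ do rewrite sum_sqr_pairs.
rewrite big_split /= exchange_big [in X in _ + X = _]exchange_big /=.
congr (_ + _); apply: eq_bigr => i _.
  rewrite -sum_bool_card big_distrl /=.
  by apply: eq_bigr => t _; case: (P i t); rewrite ?mul1r ?mul0r ?expr0n.
rewrite -sum_bool_card !big_distrl /=; apply: eq_bigr => t _.
by case: (P i.1 t); case: (P i.2 t); rewrite ?mul1r ?mul0r ?mulr0.
Qed.

Theorem theorem3 (n : nat) (hn : (1 <= n)%N) (c' : pseudo_adder n)
  (hcons : conservative c') (hdet : chain_determined c') :
  mean_squared_error c' =
  1 / 2 ^+ (2 * n) *
  ((\sum_(C : carry_chain n) (nu C)%:R * (EC c' C)%:~R ^+ 2) +
   (\sum_(CC : carry_chain n * carry_chain n | CC.1 != CC.2)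
      (nu2 CC.1 CC.2)%:R * (EC c' CC.1)%:~R * (EC c' CC.2)%:~R)) :> rat.
Proof.
rewrite /mean_squared_error /uniform_expectation -big_distrr /=.
congr (_ * _).
  by rewrite card_prod card_ord -expnD addnn -mul2n natrX div1r.
transitivity (\sum_(ab : input n * input n)
  (\sum_(C : carry_chain n)
     (generates C ab.1 ab.2)%:R * (EC c' C)%:~R) ^+ 2 : rat).
  apply: eq_bigr => -[a b] _ /=.
  (* Squaring removes the absolute value, so the signed identity applies. *)
  rewrite /Er -rmorphXn /= real_normK ?num_real // (sum_error_EC hcons hdet).
  rewrite rmorphXn rmorph_sum /=; congr (_ ^+ 2); apply: eq_bigr => C _.
  by rewrite rmorphM /= rmorph_nat.
exact: (sum_sqr_indicators (fun C (ab : input n * input n) =>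
  generates C ab.1 ab.2) (fun C => (EC c' C)%:~R)).
Qed.
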